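(* Let $\mathfrak{X}=(X,\{R_r\}_{r=0}^d)$ be a formally self-dual association scheme that is $P$-polynomial (and hence $Q$-polynomial), with base vertex $u_0$, and suppose $\mathrm{Hom}_0(X)+\mathrm{Hom}_1(X)=L_0(X)+L_1(X)$. If $d\ge 6$, then $\mathfrak{X}$ is (isomorphic to) the Hamming scheme $H(d,q)$ for some $q$.
   Context: $A_0,\dots,A_d$ are the adjacency matrices in a $P$-polynomial ordering ($(X,R_1)$ distance-regular with $R_i$ its distance-$i$ relation). Formally self-dual: there is an ordering $E_0,\dots,E_d$ of the primitive idempotents such that the first eigenmatrix $P$ (defined by $A_j=\sum_i P_{ij}E_i$) equals the second eigenmatrix $Q$ (defined by $E_j=|X|^{-1}\sum_i Q_{ij}A_i$); this ordering is then $Q$-polynomial, and $L_j(X)$ denotes the column space of $E_j$ (as functions on $X$). Shells $X_r=\{x:(u_0,x)\in R_r\}$. For $z\in X_j$, $f_z(x)=1$ if $x\in X_i$ with $i\ge j$ and $(x,z)\in R_{i-j}$, $f_z(x)=0$ otherwise; $\mathrm{Hom}_j(X)=\mathrm{span}\{f_z: z\in X_j\}$. The Hamming scheme $H(d,q)$ has vertex set $\{0,\dots,q-1\}^d$ with $R_r$ = ''differ in exactly $r$ coordinates''. *)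

(* Defs.v *)
From mathcomp Require Import all_boot all_order all_algebra all_field.
Set Implicit Arguments. Unset Strict Implicit. Unset Printing Implicit Defensive.
Import GRing.Theory Num.Theory.
Local Open Scope ring_scope.

(* Vertex set X = 'I_n (so |X| = n); the relation index of a pair is
   R x y : 'I_d.+1, i.e. (x,y) \in R_r  <->  R x y = r. *)

Definition edge (n d : nat) (R : 'I_n -> 'I_n -> 'I_d.+1) : rel 'I_n :=
  fun x y => (R x y == 1%N :> nat).

Definition is_distance (n d : nat) (R : 'I_n -> 'I_n -> 'I_d.+1) : Prop :=
  forall x y,
    (exists p : seq 'I_n,
        [/\ path (edge R) x p, last x p = y & size p = R x y]) /\
    (forall p : seq 'I_n, path (edge R) x p -> last x p = y ->
        (R x y <= size p)%N).

(* symmetric association scheme axioms (R_0 = diagonal is part of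
   is_distance), each R_r nonempty, intersection numbers well-defined. *)
Definition assoc_scheme (n d : nat) (R : 'I_n -> 'I_n -> 'I_d.+1) : Prop :=
  [/\ (forall x y, R x y = R y x),
      (forall r : 'I_d.+1, exists x y, R x y = r)
    & (forall (i j : 'I_d.+1) x y x' y', R x y = R x' y' ->
        #|[set z | (R x z == i) && (R z y == j)]|
        = #|[set z | (R x' z == i) && (R z y' == j)]|)].

Definition P_polynomial_scheme (n d : nat) (R : 'I_n -> 'I_n -> 'I_d.+1) :
  Prop := assoc_scheme R /\ is_distance R.

Definition adjmx (n d : nat) (R : 'I_n -> 'I_n -> 'I_d.+1) (i : 'I_d.+1)
  : 'M[algC]_n := \matrix_(x, y) (R x y == i)%:R.

(* E_0..E_d are the primitive idempotents of the Bose-Mesner algebra and the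
   first eigenmatrix (A_j = sum_i P_ij E_i) equals the second eigenmatrix
   (E_j = |X|^-1 sum_i Q_ij A_i), i.e. the scheme is formally self-dual with
   respect to this ordering. *)
Definition formally_self_dual_ordering (n d : nat)
  (R : 'I_n -> 'I_n -> 'I_d.+1) (E : 'I_d.+1 -> 'M[algC]_n)
  (P : 'M[algC]_d.+1) : Prop :=
  [/\ (forall i j, E i *m E j = if i == j then E i else 0),
      (forall i, E i != 0),
      \sum_i E i = 1%:M,
      (forall j, adjmx R j = \sum_i P i j *: E i)
    & (forall j, E j = (n%:R)^-1 *: \sum_i P i j *: adjmx R i)].

Definition fz (n d : nat) (R : 'I_n -> 'I_n -> 'I_d.+1) (u0 z x : 'I_n)
  : algC :=
  ((R u0 z <= R u0 x)%N && (R x z == (R u0 x - R u0 z)%N :> nat))%:R.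

(* Matrix whose rows span Hom_j(X): row z is f_z if z \in X_j, else 0. *)
Definition Hom_mx (n d : nat) (R : 'I_n -> 'I_n -> 'I_d.+1) (u0 : 'I_n)
  (j : nat) : 'M[algC]_n :=
  \matrix_(z, x) (if (R u0 z == j :> nat) then fz R u0 z x else 0).

(* Matrix whose rows span L_j(X) = column space of E_j. *)
Definition L_mx (n : nat) (Ej : 'M[algC]_n) : 'M[algC]_n := Ej^T.

Definition is_Hamming (n d : nat) (R : 'I_n -> 'I_n -> 'I_d.+1) : Prop :=
  exists q : nat, exists phi : 'I_n -> {ffun 'I_d -> 'I_q},
    bijective phi /\
    forall x y, (R x y : nat) = #|[set k | phi x k != phi y k]|.

(* Main.v *)
(** For z adjacent to u_0 let S_z be the set of vertices closer to z than to
    u_0, so f_z is the indicator of S_z.  Since f_z is in L_0 + L_1, it satisfies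
    A f_z = theta_1 f_z + c, and evaluation at u_0 gives c = 1: every vertex
    outside S_z has exactly one neighbour in S_z.  Evaluating at the neighbours
    of u_0, the local graph at u_0 is a disjoint union of cliques of some size
    q - 1, and theta_1 = theta_0 - q, theta_2 = theta_1 - q.

    By self-duality the rows of E_1 are y |-> theta_{d(x,y)} / n, and they lie in
    Hom_0 + Hom_1, so theta_{d(x,y)} is affine in the values f_z(y).  Inverting
    this relation expresses f_z(y) by the theta_{d(w,y)}, with w on the line made
    of u_0 and the clique of z; this forces theta_{i+1} = theta_i - q for all i.
    Hence d(x,y) itself is affine in the f_z(y).  Each clique meets at most one
    of the relations "x in S_z", which defines one coordinate of x per clique, and
    the affine relation says that d is the Hamming distance of the coordinates.
    The unique neighbour in S_z of a vertex outside S_z realises the change of one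
    coordinate to z, whence surjectivity. *)

Require Import Defs.
From mathcomp Require Import all_boot all_order all_algebra all_field.
From mathcomp Require Import zify ring.
Import GRing.Theory Num.Theory.
Local Open Scope ring_scope.

(** * Distance-regular graphs with affine eigenvalue data *)

Section DistanceRegular.

Set Implicit Arguments.
Unset Strict Implicit.
Unset Printing Implicit Defensive.

Variables (T : finType) (F : numFieldType) (d : nat) (dist : T -> T -> nat).
Variable u0 : T.
(** Stands for column 1 of the eigenmatrix: [theta i] is the eigenvalue of A_1 on E_i and, by
    self-duality, the entry of n E_1 at pairs at distance i. *)
Variable theta : nat -> F.

Hypothesis dist_sym : forall x y, dist x y = dist y x.
Hypothesis dist_eq0 : forall x y, (dist x y == 0%N) = (x == y).
Hypothesis dist_tri : forall x y w, dist x y = 1%N -> (dist x w <= (dist y w).+1)%N.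
Hypothesis dist_step : forall x y, x != y ->
  exists2 z, dist x z = 1%N & (dist z y).+1 = dist x y.
Hypothesis dist_le : forall x y, (dist x y <= d)%N.
Hypothesis dist_onto : forall r, (r <= d)%N -> exists x y, dist x y = r.
Hypothesis dist_reg : forall i j x y x' y', dist x y = dist x' y' ->
  #|[set z | (dist x z == i) && (dist z y == j)]|
  = #|[set z | (dist x' z == i) && (dist z y' == j)]|.
Hypothesis d_ge2 : (2 <= d)%N.

Let D := [set z | dist u0 z == 1%N].

(* For [z] in [D] this is the support of the function f_z. *)
Let S z x : bool := dist u0 x == (dist z x).+1.

Hypothesis S_eigen : forall z, z \in D -> exists c, forall x,
  \sum_(y | dist x y == 1%N) (S z y)%:R = theta 1 * (S z x)%:R + c.
Hypothesis theta_rep : forall x y, theta (dist x y) = theta (dist x u0)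
  + \sum_(z in D) (theta (dist x z) - theta (dist x u0)) * (S z y)%:R.
Hypothesis theta_eigen : forall x w,
  \sum_(y | dist x y == 1%N) theta (dist y w) = theta 1 * theta (dist x w).
Hypothesis theta0 : forall x, theta 0 = #|[set y | dist x y == 1%N]|%:R.

Lemma distxx x : dist x x = 0%N.
Proof. by apply/eqP; rewrite dist_eq0. Qed.

Lemma dist1_neq x y : dist x y = 1%N -> x != y.
Proof. by move=> h; rewrite -dist_eq0 h. Qed.

(** Some pair is at distance i+1; regularity applied to the diagonal pairs (x,x) and (u0,u0) moves
    it to the base point. *)
Lemma dist_geodesic i : (i < d)%N ->
  exists x y, [/\ dist u0 x = i, dist x y = 1%N & dist u0 y = i.+1].
Proof.
move=> /dist_onto[x [y xy]].
have: (0 < #|[set z | (dist u0 z == i.+1) && (dist z u0 == i.+1)]|)%N.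
  rewrite (_ : #|_| = #|[set z | (dist x z == i.+1) && (dist z x == i.+1)]|).
    by apply/card_gt0P; exists y; rewrite inE (dist_sym y) xy eqxx.
  by apply: dist_reg; rewrite !distxx.
case/card_gt0P=> w; rewrite inE => /andP[/eqP u0w _].
have wu0 : w != u0 by rewrite -dist_eq0 dist_sym u0w.
have [v wv] := dist_step wu0; rewrite (dist_sym w u0) u0w => -[vu0].
by exists v, w; split; rewrite // dist_sym.
Qed.

(** * Unique neighbours in the sets [S z] *)

Lemma dist_u0_D v : v \in D -> dist u0 v = 1%N.
Proof. by rewrite inE => /eqP. Qed.

Lemma S_u0 z : S z u0 = false.
Proof. by rewrite /S distxx. Qed.

Lemma S_D z y : y \in D -> S z y = (y == z).
Proof. by rewrite inE /S => /eqP->; rewrite eqSS eq_sym dist_eq0 eq_sym. Qed.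

(** The constant is read off at [u0], which lies outside [S z] and has [z] as its only neighbour
    inside. *)
Lemma S_sum z x : z \in D ->
  \sum_(y | dist x y == 1%N) (S z y)%:R = theta 1 * (S z x)%:R + 1.
Proof.
move=> zD; have [c Sc] := S_eigen zD; rewrite Sc; congr (_ + _).
have := Sc u0; rewrite S_u0 mulr0 add0r => <-.
rewrite (bigD1 z) /=; last by rewrite dist_u0_D.
rewrite S_D // eqxx big1 ?addr0 // => y /andP[yD yz].
by rewrite S_D ?inE // (negbTE yz).
Qed.

Lemma S_nbrs z x : z \in D ->
  #|[set y | (dist x y == 1%N) && S z y]|%:R = theta 1 * (S z x)%:R + 1 :> F.
Proof.
move=> zD; rewrite -(S_sum x zD) -sum1dep_card natr_sum big_mkcondr.
by apply: eq_bigr => y _; case: (S z y).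
Qed.

Lemma S_nbr1 z x : z \in D -> ~~ S z x ->
  #|[set y | (dist x y == 1%N) && S z y]| = 1%N.
Proof.
move=> zD /negbTE zx; have := S_nbrs x zD; rewrite zx mulr0 add0r.
by move/eqP; rewrite (eqr_nat F _ 1) => /eqP.
Qed.

Lemma S_nbr_uniq z x y y' : z \in D -> ~~ S z x -> dist x y = 1%N ->
  dist x y' = 1%N -> S z y -> S z y' -> y = y'.
Proof.
move=> zD /(S_nbr1 zD)/eqP/cards1P[t /setP st] xy xy' zy zy'.
have := st y; have := st y'.
by rewrite !inE xy xy' zy zy' /= => /esym/eqP-> /esym/eqP->.
Qed.

(** * Cliques of the local graph at [u0] *)

Let a z := #|[set w | (dist u0 w == 1%N) && (dist w z == 1%N)]|.

Lemma a_const z w : z \in D -> w \in D -> a z = a w.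
Proof. by rewrite !inE => /eqP zD /eqP wD; apply: dist_reg; rewrite zD. Qed.

(** Otherwise [y] is at distance 2 from [u0], and [w], which is outside [S z], has the two
    neighbours [z] and [y] in [S z]. *)
Lemma common_nbr_in_D z w y : z \in D -> w \in D -> dist z w = 1%N ->
  dist z y = 1%N -> dist w y = 1%N -> y != u0 -> y \in D.
Proof.
move=> zD wD zw zy wy yu0; have zD' := dist_u0_D zD.
have wD' := dist_u0_D wD.
have le2 : (dist y u0 <= 2)%N.
  by have := @dist_tri y z u0; rewrite dist_sym zy (dist_sym z) zD'; exact.
have gt0 : (0 < dist y u0)%N by rewrite lt0n dist_eq0.
rewrite inE dist_sym; apply: contraT => neq1.
have y2 : dist u0 y = 2 by rewrite dist_sym; lia.
suff: y = z by move=> yz; have := distxx z; rewrite -{2}yz zy.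
apply: (@S_nbr_uniq z w) => //.
- by rewrite S_D // eq_sym dist1_neq.
- by rewrite dist_sym.
- by rewrite /S y2 zy.
- by rewrite S_D ?eqxx.
Qed.

(** The adjacent pairs (z,w) and (u0,w) have equally many common neighbours, collected in [A] and
    [B]. Since [A :\ u0] lies in [B :\ z], the two are equal, so [v] is in [A]. *)
Lemma adj_D_trans z w v : z \in D -> w \in D -> v \in D ->
  dist z w = 1%N -> dist w v = 1%N -> v != z -> dist z v = 1%N.
Proof.
move=> zD wD vD zw wv vz.
have zD' := dist_u0_D zD.
have wD' := dist_u0_D wD.
pose A := [set y | (dist z y == 1%N) && (dist y w == 1%N)].
pose B := [set y | (dist u0 y == 1%N) && (dist y w == 1%N)].
have AB : #|A :\ u0| = #|B :\ z|.
  have : #|A| = #|B| by apply: dist_reg; rewrite zw wD'.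
  rewrite (cardsD1 u0 A) (cardsD1 z B) !inE zw zD' wD' (dist_sym z) zD'.
  by rewrite eqxx /= => -[].
have sAB : A :\ u0 \subset B :\ z.
  apply/subsetP=> y; rewrite !inE => /and3P[yu0 /eqP zy /eqP yw].
  rewrite yw eqxx andbT (eq_sym y) (dist1_neq zy) /=.
  have : y \in D by apply: (@common_nbr_in_D z w); rewrite // dist_sym.
  by rewrite inE.
have /eqP eAB : A :\ u0 == B :\ z by rewrite eqEcard sAB AB /=.
have : v \in B :\ z.
  by move: vD; rewrite !inE vz (dist_sym v) wv => ->.
by rewrite -eAB !inE => /and3P[_ /eqP].
Qed.

(** The class of [z] under being equal or adjacent, an equivalence on [D] by [adj_D_trans]. *)
Let clique z := [set w in D | (w == z) || (dist z w == 1%N)].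

Lemma clique_sub z w : w \in clique z -> w \in D.
Proof. by rewrite inE => /andP[]. Qed.

Lemma clique_refl z : z \in D -> z \in clique z.
Proof. by move=> zD; rewrite inE zD eqxx. Qed.

Lemma clique_dist z w v : z \in D -> w \in clique z -> v \in D ->
  (v \in clique z) = (w == v) || (dist w v == 1%N).
Proof.
move=> zD wz vD; have wD := clique_sub wz.
have zw : (w == z) || (dist z w == 1%N) by move: wz; rewrite inE wD.
rewrite [v \in _]inE vD /=.
case/predU1P: zw => [->|/eqP zw]; first by rewrite eq_sym.
apply/idP/idP.
  case/predU1P=> [->|/eqP zv]; first by rewrite (dist_sym w) zw orbT.
  case: (eqVneq w v) => //= wv; apply/eqP.
  by apply: (@adj_D_trans w z v); rewrite // 1?dist_sym // eq_sym.
case/predU1P=> [<-|/eqP wv]; first by rewrite zw orbT.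
case: (eqVneq v z) => //= vz; apply/eqP.
by apply: (@adj_D_trans z w v).
Qed.

Lemma clique_eq z w : z \in D -> w \in clique z -> clique w = clique z.
Proof.
move=> zD wz; apply/setP=> v; have [vD|vD] := boolP (v \in D); last first.
  by rewrite !inE in vD *; rewrite (negbTE vD).
have wD := clique_sub wz.
by rewrite (clique_dist zD wz vD) (clique_dist wD (clique_refl wD) vD).
Qed.

Lemma clique_dist1 z w v : z \in D -> w \in clique z -> v \in clique z ->
  w != v -> dist w v = 1%N.
Proof.
move=> zD wz vz /negbTE wv.
by have := clique_dist zD wz (clique_sub vz); rewrite vz wv => /esym/eqP.
Qed.

Lemma dist_D_le2 w v : w \in D -> v \in D -> (dist w v <= 2)%N.
Proof.
rewrite !inE => /eqP wD /eqP vD.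
by have := @dist_tri w u0 v; rewrite vD dist_sym wD; exact.
Qed.

Lemma clique_dist2 z w v : z \in D -> w \in clique z -> v \in D ->
  v \notin clique z -> dist w v = 2.
Proof.
move=> zD wz vD; rewrite (clique_dist zD wz vD) negb_or -dist_eq0 => /andP[h0 h1].
by have := dist_D_le2 (clique_sub wz) vD; lia.
Qed.

(** * Line size and the first eigenvalues *)

Section LineSize.

Variable z0 : T.
Hypothesis z0D : z0 \in D.
Hypothesis z0_nbr : exists y, dist z0 y = 1%N /\ dist u0 y = 2%N.

Variable q : nat.
Hypothesis card_clique_z0 : #|clique z0|.+1 = q.

Lemma card_clique_a z : z \in D -> #|clique z| = (a z).+1.
Proof.
move=> zD; rewrite (cardsD1 z) clique_refl // add1n; congr _.+1.
apply: eq_card => w; rewrite !inE (dist_sym w z).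
by case: (eqVneq w z) => //= ->; rewrite distxx andbF.
Qed.

Lemma card_clique z : z \in D -> (#|clique z|).+1 = q.
Proof. by move=> zD; rewrite -card_clique_z0 !card_clique_a // (a_const zD z0D). Qed.

Lemma q_neq0 : q%:R != 0 :> F.
Proof. by rewrite -card_clique_z0 pnatr_eq0. Qed.

Let b z := #|[set y | (dist z y == 1%N) && S z y]|.

(** The neighbours of [z] are [u0], the [a z] ones in [D] and the [b z] ones farther out; [q.-1] is
    [1 + a z]. *)
Lemma card_nbrs z : z \in D ->
  #|[set y | dist z y == 1%N]| = (q.-1 + b z)%N.
Proof.
move=> zD; have zD' := dist_u0_D zD.
rewrite (cardsD1 u0) inE dist_sym zD' eqxx -(cardsID [set y | S z y]).
have -> : #|([set y | dist z y == 1%N] :\ u0) :&: [set y | S z y]| = b z.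
  by apply: eq_card => y; rewrite !inE; case: eqP => [->|] //=; rewrite S_u0 andbF.
have -> : #|([set y | dist z y == 1%N] :\ u0) :\: [set y | S z y]| = a z.
  apply: eq_card => y; rewrite !inE (dist_sym y z).
  case: (eqVneq (dist z y) 1%N) => zy; last by rewrite !andbF.
  rewrite /S zy andbT -dist_eq0 (dist_sym y).
  have := dist_tri u0 (etrans (dist_sym y z) zy); rewrite (dist_sym z) zD' (dist_sym y).
  lia.
by rewrite -(card_clique zD) card_clique_a //= addnCA addnC.
Qed.

(** Compares the valency q - 1 + b with b = theta 1 + 1, which is [S_nbrs] at x = z0. *)
Lemma theta1E : theta 1 = theta 0 - q%:R.
Proof.
rewrite (theta0 z0) card_nbrs // natrD (S_nbrs z0 z0D) /S distxx.
rewrite dist_u0_D // eqxx mulr1 -card_clique_z0 -natr1 /=; ring.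
Qed.

(** The eigenvalue equation at (z0,u0) reads theta 0 + (q-2) theta 1 + b theta 2 = (theta 1)^2; with
    b = theta 1 + 1 it factors, and b is cancelled. *)
Lemma theta2E : theta 2 = theta 1 - q%:R.
Proof.
have zD' := dist_u0_D z0D.
have bE : (b z0)%:R = theta 1 + 1.
  by rewrite (S_nbrs z0 z0D) /S distxx zD' eqxx mulr1.
have b_neq0 : (b z0)%:R != 0 :> F.
  rewrite pnatr_eq0 -lt0n; apply/card_gt0P; case: z0_nbr => y [zy u0y].
  by exists y; rewrite inE /S zy u0y eqxx.
have := theta_eigen z0 u0; rewrite (dist_sym z0 u0) zD'.
rewrite (bigD1 u0) /=; last by rewrite dist_sym zD'.
rewrite distxx (bigID (S z0)) /=.
rewrite (eq_bigr (fun _ => theta 2)); last first.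
  by move=> y /andP[/andP[/eqP zy _]]; rewrite /S zy dist_sym => /eqP->.
rewrite [X in _ + (_ + X)](eq_bigr (fun _ => theta 1)); last first.
  move=> y /andP[/andP[/eqP zy yu0]]; rewrite /S zy => y2.
  congr theta; rewrite -dist_eq0 in yu0.
  have := @dist_tri y z0 u0; rewrite dist_sym zy (dist_sym z0) zD' => /(_ erefl).
  by rewrite (dist_sym y) in yu0 *; lia.
rewrite !sumr_const.
have E1 : #|(fun y : T => (dist z0 y == 1%N) && (y != u0) && S z0 y)| = b z0.
  apply: eq_card => y; rewrite inE unfold_in.
  by case: (eqVneq y u0) => [->|]; rewrite ?S_u0 ?andbF ?andbT.
have := card_nbrs z0D; rewrite -E1 (cardsD1 u0) inE dist_sym zD' eqxx.
have -> : #|[set y | dist z0 y == 1%N] :\ u0| = (b z0 +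
  #|(fun y : T => (dist z0 y == 1%N) && (y != u0) && ~~ S z0 y)|)%N.
  rewrite -(cardsID [set y | S z0 y]); congr (_ + _)%N; apply: eq_card => y.
    by rewrite !inE; case: (eqVneq y u0) => [->|]; rewrite ?S_u0 ?andbF ?andbT.
  by rewrite !inE unfold_in; do !case: (_ == _); case: (S _ _).
rewrite E1 [(q.-1 + _)%N]addnC addnCA => /addnI => H1.
rewrite (_ : #|(fun _ => _ && ~~ _)| = q - 2)%N; last by move: H1; lia.
rewrite -[theta 2 *+ _]mulr_natr bE -[theta 1 *+ _]mulr_natr => H.
have q2 : (2 <= q)%N by rewrite -card_clique_z0 ltnS card_gt0; apply/set0Pn; exists z0; apply: clique_refl.
move: H; rewrite natrB // => H.
apply: (mulIf b_neq0); rewrite bE.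
have th0 : theta 0 = theta 1 + q%:R by rewrite theta1E subrK.
rewrite th0 in H.
have -> : theta 2 * (theta 1 + 1) = theta 1 * theta 1 - (theta 1 + q%:R) - theta 1 * (q%:R - 2).
  rewrite -H; ring.
ring.
Qed.


(** * Affine functions and linearity of the eigenvalues *)

(** Membership in the span of 1 and the [S v], with the coefficients already solved for: [S v]
    vanishes at [u0] and is the Kronecker delta on [D]. *)
Let affine (g : T -> F) :=
  forall y, g y = g u0 + \sum_(v in D) (g v - g u0) * (S v y)%:R.

Lemma affine_theta x : affine (fun y => theta (dist x y)).
Proof. exact: theta_rep. Qed.

Lemma affine_lin c g h : affine g -> affine h -> affine (fun y => g y + c * h y).
Proof.
move=> Ag Ah y; rewrite Ag Ah mulrDr addrACA; congr (_ + _).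
rewrite mulr_sumr -big_split /=; apply: eq_bigr => v _; ring.
Qed.

Lemma affine_sum (A : {set T}) (g : T -> T -> F) :
  (forall w, affine (g w)) -> affine (fun y => \sum_(w in A) g w y).
Proof.
move=> Ag y; rewrite (eq_bigr _ (fun w _ => Ag w y)) big_split /=.
congr (_ + _); rewrite exchange_big /=; apply: eq_bigr => v _.
by rewrite -mulr_suml -sumrB.
Qed.

Lemma sum_clique_theta z v : z \in D -> v \in D ->
  \sum_(w in clique z) theta (dist w v) =
  if v \in clique z then theta 0 + (q%:R - 2) * theta 1 else (q%:R - 1) * theta 2.
Proof.
move=> zD vD; have qE : q%:R - 1 = #|clique z|%:R :> F.
  by rewrite -(card_clique zD) -natr1 addrK.
case: ifP => [vz|/negbT vz].
  rewrite (bigD1 v) //= distxx; congr (_ + _).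
  rewrite (eq_bigr (fun=> theta 1)); last first.
    by move=> w /andP[wz wv]; rewrite (clique_dist1 zD wz vz wv).
  rewrite (eq_bigl [in clique z :\ v]) => [|w]; last by rewrite !inE andbC.
  rewrite sumr_const -[theta 1 *+ _]mulr_natl; congr (_ * _).
  move: qE; rewrite (cardsD1 v) vz add1n -natr1 => qE.
  by apply: (addIr 1); rewrite -qE; ring.
rewrite (eq_bigr (fun=> theta 2)) => [|w wz]; last by rewrite (clique_dist2 zD wz vD vz).
by rewrite sumr_const -[theta 2 *+ _]mulr_natl -qE.
Qed.

(* An affine function is determined by its values on [u0 |: D], so it suffices
   to compare both sides there. *)
Lemma S_theta z y : z \in D ->
  q%:R * (S z y)%:R = 1 + theta (dist z y)
    - q%:R^-1 * (theta (dist u0 y) + \sum_(w in clique z) theta (dist w y)).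
Proof.
move=> zD; have q0 := q_neq0; have th1 := theta1E; have th2 := theta2E.
pose h x := theta (dist z x)
    + - q%:R^-1 * (theta (dist u0 x) + 1 * \sum_(w in clique z) theta (dist w x)).
have Ah : affine h.
  do 2! [apply: affine_lin; first exact: affine_theta].
  by apply: affine_sum => w; apply: affine_theta.
have hu0 : h u0 = - 1.
  rewrite /h distxx dist_sym dist_u0_D // (eq_bigr (fun=> theta 1)); last first.
    by move=> w /clique_sub/dist_u0_D; rewrite dist_sym => ->.
  rewrite sumr_const -[theta _ *+ _]mulr_natl.
  have -> : #|clique z|%:R = q%:R - 1 :> F by rewrite -(card_clique zD) -natr1 addrK.
  by rewrite th1; field.
have hD v : v \in D -> h v = if v == z then q%:R - 1 else - 1.
  move=> vD; rewrite /h dist_u0_D // sum_clique_theta //.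
  case: eqP => [->|/eqP vz].
    by rewrite clique_refl // distxx th1; field.
  rewrite eq_sym in vz; case: ifP => [vC|/negbT vC].
    by rewrite (clique_dist1 zD (clique_refl zD) vC vz) th1; field.
  by rewrite (clique_dist2 zD (clique_refl zD) vD vC) th2; field.
have := Ah y; rewrite (bigD1 z) //= big1 => [|v /andP[vD vz]]; last first.
  by rewrite hu0 hD // (negbTE vz) subrr mul0r.
rewrite hu0 (hD z zD) eqxx addr0 => hy.
transitivity (1 + h y); last by rewrite /h; ring.
by rewrite hy; ring.
Qed.

(** Take x at distance i from [u0] and z in [D] at distance i+1 from x. Then x lies in no [S w] for
    w in the clique of z, so by [S_theta] all these w are at the same eigenvalue from x, and
    [S_theta] collapses to the recurrence. *)
Lemma theta_step i : (i < d)%N -> theta i.+1 = theta i - q%:R.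
Proof.
case/dist_geodesic=> x [y [u0x xy u0y]].
(* Exchanging the ends of the pair (x,u0) turns the neighbour [y] of [x] into the required neighbour
   [z] of [u0]. *)
have := dist_reg (1%N) i.+1 (dist_sym x u0).
move/eqP; rewrite eqn_leq => /andP[le _].
have: (0 < #|[set v | (dist u0 v == 1%N) && (dist v x == i.+1)]|)%N.
  apply: leq_trans le; apply/card_gt0P; exists y.
  by rewrite inE xy (dist_sym y) u0y !eqxx.
case/card_gt0P=> z; rewrite inE => /andP[u0z /eqP zx].
have zD : z \in D by rewrite inE.
have Sw w : w \in clique z -> S w x = false.
  move=> wz; rewrite /S u0x; case: (eqVneq z w) => [<-|zw]; first by rewrite zx; lia.
  have := dist_tri x (clique_dist1 zD (clique_refl zD) wz zw); lia.
have thw w : w \in clique z -> theta (dist w x) = theta i.+1.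
  move=> wz; have := S_theta x (clique_sub wz); have := S_theta x zD.
  rewrite !Sw ?clique_refl // (clique_eq zD wz) zx => -> /eqP.
  by rewrite (inj_eq (addIr _)) (inj_eq (addrI _)) => /eqP.
have := S_theta x zD; rewrite Sw ?clique_refl // mulr0 zx u0x (eq_bigr _ thw).
rewrite sumr_const -[theta _ *+ _]mulr_natl.
have -> : #|clique z|%:R = q%:R - 1 :> F by rewrite -(card_clique zD) -natr1 addrK.
move=> H; have q0 := q_neq0.
(* The zero is there to be replaced by the right side of [H]. *)
have -> : theta i.+1 = theta i - q%:R + q%:R * 0 by rewrite H; field.
by rewrite mulr0 addr0.
Qed.

Lemma theta_lin i : (i <= d)%N -> theta i = #|D|%:R - q%:R * i%:R.
Proof.
elim: i => [|i IH] id; first by rewrite mulr0 subr0 (theta0 u0).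
by rewrite theta_step // (IH (ltnW id)) -natr1; ring.
Qed.

(** * Distances as affine functions of the indicators *)

Lemma S_dist z y : z \in D ->
  (q * (S z y) + q * dist z y = 1 + dist u0 y + \sum_(w in clique z) dist w y)%N.
Proof.
move=> zD; have q0 := q_neq0; apply/eqP; rewrite -(eqr_nat F) !natrD !natrM.
rewrite S_theta // !theta_lin // (eq_bigr (fun w => #|D|%:R + - q%:R * (dist w y)%:R)); last first.
  by move=> w _; rewrite theta_lin // mulNr.
rewrite big_split /= sumr_const -[_ *+ #|clique z|]mulr_natl -mulr_sumr.
have -> : #|clique z|%:R = q%:R - 1 :> F by rewrite -(card_clique zD) -natr1 addrK.
by rewrite natr_sum; apply/eqP; field.
Qed.

Let m z x := (\sum_(w in clique z) S w x)%N.

(** Summing [S_dist] over the clique determines the sum of the distances to its members;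
    substituting it back leaves a multiple of q, which is cancelled. *)
Lemma dist_D z x : z \in D -> (dist z x + m z x + S z x = (dist u0 x).+1)%N.
Proof.
move=> zD; have H := S_dist x zD.
have cE : #|clique z| = q.-1 by rewrite -(card_clique zD).
have : \sum_(w in clique z) (q * S w x + q * dist w x)%N =
  \sum_(w in clique z) (1 + dist u0 x + \sum_(v in clique z) dist v x)%N.
  apply: eq_bigr => w wz; rewrite (S_dist x (clique_sub wz)).
  by rewrite (clique_eq zD wz).
rewrite big_split /= -!big_distrr /= sum_nat_const cE -/(m z x).
move: H; move: (\sum_(w in _) _)%N => s.
have : (0 < q)%N by rewrite -card_clique_z0.
case: (q) => // p _ /=; nia.
Qed.

(** This is [theta_rep] with [theta] linear and each difference of distances replaced through
    [dist_D]; terms are placed so that no subtraction occurs. *)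
Lemma dist_affine x y :
  (dist x y + \sum_(z in D) (m z x + S z x) * S z y
   = dist u0 x + \sum_(z in D) S z y)%N.
Proof.
have q0 := q_neq0; apply/eqP; rewrite -(eqr_nat F) !natrD !natr_sum.
have := theta_rep x y; rewrite !theta_lin // (dist_sym x u0).
rewrite (eq_bigr (fun z => q%:R * ((m z x + S z x) * S z y)%:R - q%:R * (S z y)%:R)).
  rewrite sumrB -!mulr_sumr => H; apply/eqP/(mulfI q0).
  rewrite -[X in X = _](addrK (#|D|%:R - q%:R * (dist x y)%:R)) {2}H; ring.
move=> z zD; have /(congr1 (fun n => n%:R : F)) := dist_D x zD.
rewrite theta_lin // -natr1 !natrD natrM natrD (dist_sym x z) => E.
rewrite (_ : (dist u0 x)%:R = (dist z x)%:R + (m z x)%:R + (S z x)%:R - 1 :> F).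
  by ring.
by rewrite E addrK.
Qed.

(** Makes coordinates well defined: no other member w of the clique of z has x in [S w]. *)
Lemma m_cond z x : z \in D -> S z x -> m z x = 1%N.
Proof. by move=> zD zx; have := dist_D x zD; rewrite zx (eqP zx); lia. Qed.

(** Case y = x of [dist_affine], where [m_cond] turns each product into [S z x] taken twice. *)
Lemma dist_u0 x : dist u0 x = (\sum_(z in D) S z x)%N.
Proof.
have := dist_affine x x; rewrite distxx add0n.
rewrite (eq_bigr (fun z => S z x + S z x)%N); first by rewrite big_split => /addIn ->.
move=> z zD; case: (boolP (S z x)) => [zx|_]; last by rewrite muln0.
by rewrite m_cond // zx.
Qed.


(** * Coordinates and the Hamming distance *)

Let cliques := [set clique z | z in D].

Lemma cliquesP C : C \in cliques -> exists2 z, z \in D & C = clique z.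
Proof. by case/imsetP=> z zD ->; exists z. Qed.

Lemma sum_cliques (g : T -> nat) :
  (\sum_(z in D) g z = \sum_(C in cliques) \sum_(z in C) g z)%N.
Proof.
rewrite (partition_big clique (fun C => C \in cliques)) => [|z zD]; last exact: imset_f.
apply: eq_bigr => C /cliquesP[z zD ->]; apply: eq_bigl => w.
apply/andP/idP => [[wD /eqP <-]|wz]; first exact: clique_refl.
by split; [exact: clique_sub wz | rewrite (clique_eq zD wz)].
Qed.

(* The coordinate of [x] in the direction of the line [u0 |: C], with [None]
   standing for [u0]. *)
Let coord (C : {set T}) x : option T := [pick z in C | S z x].

Lemma coord_S C x z : C \in cliques -> z \in C -> S z x = (coord C x == Some z).
Proof.
move=> /cliquesP[v vD ->] zv; rewrite /coord; case: pickP => [w /andP[wv wx]|]; last first.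
  by move/(_ z); rewrite zv.
have := m_cond vD; have := m_cond (clique_sub wv) wx.
rewrite /m (clique_eq vD wv) (bigD1 w) //= wx => -[] /eqP.
rewrite sum_nat_eq0 => /forallP/(_ z)/implyP mz _.
case: (eqVneq w z) => [<-|wz]; first by rewrite wx eqxx.
have := mz; rewrite zv eq_sym wz => /(_ isT); rewrite eqb0 => /negbTE->.
by apply/esym/eqP=> -[/eqP]; rewrite (negbTE wz).
Qed.

Lemma coord_in C x z : coord C x = Some z -> z \in C.
Proof. by rewrite /coord; case: pickP => // w /andP[wC _] [<-]. Qed.

Lemma sum_coord C x : C \in cliques -> (\sum_(z in C) S z x = (coord C x != None))%N.
Proof.
move=> CC; rewrite (eq_bigr (fun z => nat_of_bool (coord C x == Some z))); last first.
  by move=> z zC; rewrite (coord_S x CC zC).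
case E: (coord C x) => [w|]; last by rewrite big1.
rewrite (bigD1 w) ?(coord_in E) //= eqxx big1 ?addn0 // => z /andP[_ /negbTE zw].
by apply/eqP; rewrite eqb0; apply: contraFN zw => /eqP[->].
Qed.

(** Both sides of [dist_affine] are split over the cliques; [eE] checks one clique by cases on its
    two coordinates. *)
Lemma dist_coord x y :
  dist x y = #|[set C in cliques | coord C x != coord C y]|.
Proof.
pose e (C : {set T}) := (coord C x != coord C y : nat).
have eE C : C \in cliques -> (\sum_(z in C) S z x + \sum_(z in C) S z y
    = e C + \sum_(z in C) (m z x + S z x) * S z y)%N; last first.
  have := dist_affine x y; rewrite dist_u0 !sum_cliques -big_split.
  rewrite [X in _ = X](eq_bigr _ eE) big_split => /addIn ->.
  rewrite -sum1_card big_mkcond [RHS]big_mkcond /=; apply: eq_bigr => C _.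
  by rewrite inE /e; case: (C \in cliques); case: (_ == _).
move=> CC; rewrite !sum_coord //.
(* On a clique [m z x] tells whether the coordinate of [x] is set, so only the [z] naming the
   coordinate of [y] contributes. *)
rewrite (eq_bigr (fun z => if coord C y == Some z then (coord C x != None) + (coord C x == Some z) else 0))%N.
  rewrite -big_mkcondr /e; case Ey: (coord C y) => [w|].
    rewrite (bigD1 w) ?(coord_in Ey) ?eqxx //= big1 ?addn0.
      by case: (coord C x) => //= v; case: (_ == _).
    by move=> z /andP[/andP[_ /eqP[->]]]; rewrite eqxx.
  by rewrite big1 => [|z /andP[_]] //; case: (coord C x).
move=> z zC; rewrite -(coord_S y CC zC); case: (S z y); rewrite ?muln0 // muln1.
case/cliquesP: (CC) (zC) => v vD Cv; rewrite Cv => zv.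
by rewrite /m (clique_eq vD zv) -Cv sum_coord // (coord_S x CC zC).
Qed.

(** A vertex at distance d from [u0] has every coordinate set: were one unset, [dist_D] would put
    the vertex at distance d+1 from the members of that clique. *)
Lemma card_cliques : #|cliques| = d.
Proof.
have : exists x, dist u0 x = d.
  have dE : d = d.-1.+1 by rewrite prednK // (leq_trans _ d_ge2).
  have : (d.-1 < d)%N by rewrite -dE.
  by case/dist_geodesic=> _ [x [_ _]]; rewrite -dE; exists x.
case=> x u0x; rewrite -[RHS]u0x dist_u0 sum_cliques -sum1_card.
apply: eq_bigr => C CC; case/cliquesP: (CC) => z zD Cz.
have := dist_D x zD; rewrite u0x /m -Cz sum_coord //.
case E: (coord C x) => [w|] //=; have zC : z \in C by rewrite Cz clique_refl.
rewrite (coord_S x CC zC) E.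
by have := dist_le z x; rewrite !addn0 => + H; rewrite H ltnn.
Qed.

(** Starting from [u0], coordinates are set one clique at a time, by induction on the list of
    cliques already treated. *)
Lemma coord_surj (g : {set T} -> option T) :
  (forall C z, C \in cliques -> g C = Some z -> z \in C) ->
  exists x, forall C, C \in cliques -> coord C x = g C.
Proof.
move=> gP; suff [x xP] : exists x, forall C, C \in cliques ->
    coord C x = if C \in enum cliques then g C else None.
  by exists x => C CC; rewrite xP // mem_enum CC.
elim: (enum cliques) => [|C s [x xP]].
  exists u0 => C _; rewrite /coord in_nil.
  by case: pickP => // z; rewrite S_u0 andbF.
have [CC|CC] := boolP (C \in cliques); last first.
  by exists x => B BC; rewrite xP // inE; case: eqP CC BC => // -> /negbTE->.
case xg : (coord C x == g C).
  exists x => B BC; rewrite inE; case: eqP => [->|_] //=; last exact: xP.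
  exact/eqP.
case gC : (g C) xg => [z|] xg; last first.
  by move: xg; rewrite (xP C CC); case: ifP => // _; rewrite gC.
have zC := gP _ _ CC gC.
have zD : z \in D by case/cliquesP: (CC) zC => v vD -> /clique_sub.
have zx : ~~ S z x by rewrite (coord_S x CC zC) xg.
(* The neighbour of [x] in [S z] has coordinate [z] at [C]; being at distance 1 from [x], it differs
   from [x] in no other coordinate. *)
have /eqP/cards1P[y /setP/(_ y)] := S_nbr1 zD zx.
rewrite !inE eqxx => /andP[/eqP xy zy].
exists y => B BC; rewrite inE; case: eqP => [->|/eqP BneC] /=.
  by rewrite gC; apply/eqP; rewrite -(coord_S y CC zC).
rewrite -xP //; apply/esym/eqP; apply: contraT => Bxy.
have yC : coord C y = Some z by apply/eqP; rewrite -(coord_S y CC zC).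
have := xy; rewrite dist_coord (cardsD1 C) (cardsD1 B) !inE CC BC Bxy yC xg.
by rewrite (negbTE BneC).
Qed.

(** * The isometry with the Hamming scheme *)

Lemma hamming_isometry : exists phi : T -> {ffun 'I_d -> 'I_q},
  bijective phi /\ forall x y, dist x y = #|[set k | phi x k != phi y k]|.
Proof.
pose cl (k : 'I_d) := enum_val (cast_ord (esym card_cliques) k).
have clP k : cl k \in cliques by apply: enum_valP.
have cl_inj : injective cl by move=> k l /enum_val_inj/cast_ord_inj.
have cl_surj C : C \in cliques -> exists k, cl k = C.
  move=> CC; exists (cast_ord card_cliques (enum_rank_in CC C)).
  by rewrite /cl cast_ordK enum_rankK_in.
have clq k : #|cl k|.+1 = q.
  by have /cliquesP[z zD ->] := clP k; rewrite card_clique.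
(* Digit 0 encodes [None], that is [u0]; digit j+1 encodes the j-th member of the clique. *)
pose code k o : 'I_q := cast_ord (clq k)
  (if o is Some z then inord (index z (enum (cl k))).+1 else ord0).
pose decode k (i : 'I_q) :=
  if val i is j.+1 then Some (nth u0 (enum (cl k)) j) else None.
have codeK k x : decode k (code k (coord (cl k) x)) = coord (cl k) x.
  case E: (coord _ x) => [z|] //; have zC := coord_in E.
  by rewrite /decode /code /= inordK ?nth_index ?mem_enum // ltnS cardE index_mem mem_enum.
have decodeK k i : code k (decode k i) = i.
  apply: val_inj; rewrite /code /decode; case: i => -[|j] //= jq.
  have jC : (j < #|cl k|)%N by rewrite -ltnS clq.
  by rewrite index_uniq ?enum_uniq -?cardE // inordK.
pose phi x := [ffun k => code k (coord (cl k) x)].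
have phi_dist x y : dist x y = #|[set k | phi x k != phi y k]|.
  rewrite dist_coord -(card_imset _ cl_inj); apply: eq_card => C.
  rewrite inE; apply/andP/imsetP => [[/cl_surj[k <-] neq]|[k]].
    exists k; rewrite // inE !ffunE; apply: contra neq => /eqP e.
    by rewrite -codeK e codeK.
  rewrite inE !ffunE => neq ->; split=> //; apply: contra neq => /eqP e.
  by rewrite e.
exists phi; split=> //.
have phi_inj : injective phi.
  move=> x y e; apply/eqP; rewrite -dist_eq0 phi_dist e cards_eq0.
  by apply/eqP/setP => k; rewrite !inE eqxx.
have phi_surj f : exists x, phi x = f.
  pose g C := if [pick k | cl k == C] is Some k then decode k (f k) else None.
  have gE k : g (cl k) = decode k (f k).
    rewrite /g; case: pickP => [l /eqP/cl_inj->|/(_ k)] //; by rewrite eqxx.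
  have [C z /cl_surj[k <-]|x xP] := @coord_surj g.
    rewrite gE /decode; case: (f k) => -[|j] //= jq [<-].
    by rewrite -mem_enum mem_nth // -cardE -ltnS clq.
  by exists x; apply/ffunP=> k; rewrite ffunE xP // gE decodeK.
have exP f : exists x, phi x == f by have [x <-] := phi_surj f; exists x.
exists (fun f => xchoose (exP f)) => [x|f]; last exact/eqP/(xchooseP (exP f)).
by apply: phi_inj; apply/eqP/(xchooseP (exP (phi x))).
Qed.

End LineSize.

(** A geodesic of length 2 from [u0] supplies [z0] and its outer neighbour. *)
Lemma hamming_of_closer_eigen : exists q, exists phi : T -> {ffun 'I_d -> 'I_q},
  bijective phi /\ forall x y, dist x y = #|[set k | phi x k != phi y k]|.
Proof.
have [z [y [u0z zy u0y]]] := dist_geodesic d_ge2.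
have zD : z \in D by rewrite inE u0z.
exists #|clique z|.+1; apply: (hamming_isometry zD _ (erefl _)).
by exists y.
Qed.

End DistanceRegular.

(** * Distances in a P-polynomial scheme *)

Section Scheme.

Set Implicit Arguments.
Unset Strict Implicit.
Unset Printing Implicit Defensive.

Variables (n d : nat) (R : 'I_n -> 'I_n -> 'I_d.+1).

Section Distance.

Hypothesis scheme : assoc_scheme R.
Hypothesis distR : is_distance R.

Lemma scheme_sym x y : R x y = R y x.
Proof. by case: scheme. Qed.

Lemma scheme_eq0 x y : (R x y == 0%N :> nat) = (x == y).
Proof.
apply/eqP/eqP => [xy|->]; last first.
  by have [_ /(_ [::] isT erefl)] := distR y y; rewrite leqn0 => /eqP.
have [[p [_ lp sp]] _] := distR x y; have p0 := size0nil (etrans sp xy).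
by move: lp; rewrite p0.
Qed.

Lemma scheme_tri x y w : R x y = 1%N :> nat -> (R x w <= (R y w).+1)%N.
Proof.
move=> xy; have [[p [py lp <-]] _] := distR y w.
by have [_ /(_ (y :: p))] := distR x w; apply; rewrite //= /edge xy eqxx.
Qed.

Lemma scheme_step x y : x != y ->
  exists2 z, R x z = 1%N :> nat & (R z y).+1 = R x y.
Proof.
rewrite -scheme_eq0; have [[[|z p] [/= px lp sp]] _] := distR x y.
  by rewrite -sp.
move=> _; case/andP: px => /eqP xz pz; exists z => //.
apply/eqP; rewrite eqn_leq scheme_tri // andbT -sp ltnS.
by have [_ /(_ p pz lp)] := distR z y.
Qed.

Lemma scheme_onto r : (r <= d)%N -> exists x y, R x y = r :> nat.
Proof.
rewrite -ltnS => rd; case: scheme => _ /(_ (Ordinal rd)) [x [y xy]] _.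
by exists x, y; rewrite xy.
Qed.

(** For indices beyond d both sets are empty; the others are covered by the scheme axiom. *)
Lemma scheme_reg i j x y x' y' : R x y = R x' y' :> nat ->
  #|[set z | (R x z == i :> nat) && (R z y == j :> nat)]|
  = #|[set z | (R x' z == i :> nat) && (R z y' == j :> nat)]|.
Proof.
move=> /val_inj xy.
have out k u v : (d < k)%N -> (R u v == k :> nat) = false.
  by move=> dk; apply/ltn_eqF/(leq_trans (ltn_ord _) dk).
have [id|id] := ltnP i d.+1; last first.
  by apply: eq_card => z; rewrite !inE !(out i).
have [jd|jd] := ltnP j d.+1; last first.
  by apply: eq_card => z; rewrite !inE !(out j) // !andbF.
by case: scheme => _ _ /(_ (Ordinal id) (Ordinal jd) _ _ _ _ xy).
Qed.

End Distance.

(** * Eigenmatrices, idempotents and the spaces Hom and L *)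

Variables (u0 : 'I_n) (E : 'I_d.+1 -> 'M[algC]_n) (P : 'M[algC]_d.+1).

Section Eigenmatrix.

Hypothesis R_eq0 : forall x y, (R x y == 0%N :> nat) = (x == y).
Hypothesis self_dual : formally_self_dual_ordering R E P.

(** Self-duality enters here: [P] also serves as the second eigenmatrix. *)
Lemma idempotent_entry j x y : E j x y = n%:R^-1 * P (R x y) j.
Proof.
case: self_dual => _ _ _ _ ->; rewrite mxE summxE; congr (_ * _).
rewrite (bigD1 (R x y)) //= big1 => [|i iR]; last first.
  by rewrite !mxE eq_sym (negbTE iR) mulr0.
by rewrite !mxE eqxx mulr1 addr0.
Qed.

Lemma eigenmatrix_col0 i : P i ord0 = 1.
Proof.
case: self_dual => EE E0 _ AE _.
have A0 : adjmx R ord0 = 1%:M.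
  by apply/matrixP => x y; rewrite !mxE -R_eq0.
have : E i *m 1%:M = P i ord0 *: E i.
  rewrite -A0 AE mulmx_sumr (bigD1 i) //= big1 => [|j ji]; last first.
    by rewrite -scalemxAr EE eq_sym (negbTE ji) scaler0.
  by rewrite -scalemxAr EE eqxx addr0.
rewrite mulmx1 -{1}[E i]scale1r => /eqP; rewrite -subr_eq0 -scalerBl scaler_eq0.
by rewrite (negbTE (E0 i)) orbF subr_eq0 => /eqP.
Qed.

Lemma adjmx_idempotent i j : adjmx R i *m E j = P j i *: E j.
Proof.
case: self_dual => EE _ _ -> _.
rewrite mulmx_suml (bigD1 j) //= big1 => [|k kj]; last first.
  by rewrite -scalemxAl EE (negbTE kj) scaler0.
by rewrite -scalemxAl EE eqxx addr0.
Qed.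

Lemma invn_neq0 (x : 'I_n) : n%:R^-1 != 0 :> algC.
Proof. by rewrite invr_eq0 pnatr_eq0; case: n x => // -[]. Qed.

Lemma adjmxE (i : 'I_d.+1) (v : 'I_n -> algC) x :
  \sum_y adjmx R i x y * v y = \sum_(y | R x y == i) v y.
Proof.
rewrite [RHS]big_mkcond; apply: eq_bigr => y _.
by rewrite mxE; case: eqP; rewrite ?mul1r ?mul0r.
Qed.

Lemma eigenmatrix_eigen i j x w :
  \sum_(y | R x y == i) P (R y w) j = P j i * P (R x w) j.
Proof.
have /matrixP/(_ x w) := adjmx_idempotent i j.
rewrite !mxE adjmxE idempotent_entry.
rewrite (eq_bigr _ (fun y _ => idempotent_entry j y w)) -mulr_sumr mulrCA.
exact/mulfI/(invn_neq0 x).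
Qed.

Lemma eigenmatrix_row0 i x : P ord0 i = #|[set y | R x y == i]|%:R.
Proof.
have := eigenmatrix_eigen i ord0 x x; rewrite eigenmatrix_col0 mulr1 => <-.
rewrite (eq_bigr (fun=> 1)) => [|y _]; last exact: eigenmatrix_col0.
by rewrite sumr_const; congr (_ %:R); apply: eq_card => y; rewrite inE.
Qed.

Let i1 : 'I_d.+1 := inord 1.

Hypothesis R_sym : forall x y, R x y = R y x.

(** Identifies f_z with the indicator of [S z]; the inequality in [fz] excludes x = u0, where the
    subtraction would truncate. *)
Lemma fz1 z x : R u0 z = 1%N :> nat ->
  fz R u0 z x = (R u0 x == (R z x).+1 :> nat)%:R.
Proof.
move=> u0z; rewrite /fz u0z (R_sym x z); case: (nat_of_ord (R u0 x)) => [|r] //=.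
by rewrite subn1 eqSS eq_sym.
Qed.

Lemma fz0 x : fz R u0 u0 x = 1.
Proof.
have /eqP u00 : R u0 u0 == 0%N :> nat by rewrite R_eq0.
by rewrite /fz u00 subn0 R_sym eqxx.
Qed.

Lemma row_L j (u : 'rV_n) x : (u *m L_mx (E j)) 0 x = \sum_y E j x y * u 0 y.
Proof. by rewrite mxE; apply: eq_bigr => y _; rewrite mxE mulrC. Qed.

(** A_1 scales the E_0 and E_1 components of f_z by their eigenvalues. The E_0 component is a
    constant function, and its excess over the E_1 scaling is c. *)
Lemma fz_eigen z : R u0 z = 1%N :> nat ->
  (Hom_mx R u0 1 <= L_mx (E ord0) + L_mx (E i1))%MS ->
  exists c, forall x, \sum_(y | R x y == i1) fz R u0 z y = P i1 i1 * fz R u0 z x + c.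
Proof.
move=> u0z le; have /sub_addsmxP[[a b] /= H] := submx_trans (row_sub z _) le.
have fE x : fz R u0 z x = \sum_w E ord0 x w * a 0 w + \sum_w E i1 x w * b 0 w.
  by rewrite -!row_L; have /rowP/(_ x) := H; rewrite !mxE u0z eqxx.
have AE j x (v : 'I_n -> algC) :
    \sum_(y | R x y == i1) \sum_w E j y w * v w = P j i1 * \sum_w E j x w * v w.
  rewrite exchange_big mulr_sumr; apply: eq_bigr => w _; rewrite -mulr_suml mulrA.
  congr (_ * _); have /matrixP/(_ x w) := adjmx_idempotent i1 j.
  by rewrite !mxE adjmxE.
exists ((P ord0 i1 - P i1 i1) * \sum_w n%:R^-1 * a 0 w) => x.
rewrite (eq_bigr _ (fun y _ => fE y)) big_split /= !AE fE.
rewrite (eq_bigr (fun w => n%:R^-1 * a 0 w)); first by ring.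
by move=> w _; rewrite idempotent_entry eigenmatrix_col0 mulr1.
Qed.

(** Row x of E_1 is a combination of 1 and the f_z; evaluation at [u0] and at its neighbours gives
    the coefficients. *)
Lemma eigenmatrix_rep x y : 
  (L_mx (E i1) <= Hom_mx R u0 0 + Hom_mx R u0 1)%MS ->
  P (R x y) i1 = P (R x u0) i1
  + \sum_(z | R u0 z == 1%N :> nat) (P (R x z) i1 - P (R x u0) i1) * fz R u0 z y.
Proof.
move=> le; have /sub_addsmxP[[a b] /= H] := submx_trans (row_sub x _) le.
have PE w : n%:R^-1 * P (R x w) i1 = a 0 u0
   + \sum_(z | R u0 z == 1%N :> nat) b 0 z * fz R u0 z w.
  have /rowP/(_ w) := H; rewrite !mxE idempotent_entry R_sym => ->.
  congr (_ + _); last first.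
    rewrite [RHS]big_mkcond; apply: eq_bigr => z _.
    by rewrite mxE; case: eqP; rewrite // mulr0.
  rewrite (bigD1 u0) //= mxE R_eq0 eqxx fz0 mulr1 big1 ?addr0 // => z zu0.
  by rewrite mxE R_eq0 eq_sym (negbTE zu0) mulr0.
have Pu0 : n%:R^-1 * P (R x u0) i1 = a 0 u0.
  rewrite PE big1 ?addr0 // => z /eqP u0z.
  have /eqP u00 : R u0 u0 == 0%N :> nat by rewrite R_eq0.
  by rewrite fz1 // u00 mulr0.
have PD z : R u0 z = 1%N :> nat -> n%:R^-1 * (P (R x z) i1 - P (R x u0) i1) = b 0 z.
  move=> u0z; rewrite mulrBr Pu0 PE addrC addKr (bigD1 z) ?u0z //= big1.
    have /eqP zz : R z z == 0%N :> nat by rewrite R_eq0.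
    by rewrite fz1 // u0z zz mulr1 addr0.
  move=> v /andP[/eqP u0v vz]; rewrite fz1 // u0z eqSS eq_sym R_eq0.
  by rewrite (negbTE vz) mulr0.
apply: (mulfI (invn_neq0 x)); rewrite mulrDr Pu0 PE mulr_sumr; congr (_ + _).
by apply: eq_bigr => z /eqP u0z; rewrite mulrA PD.
Qed.

End Eigenmatrix.
End Scheme.

(** * Reduction of the scheme to the distance-regular setting *)

Theorem theorem3p2 (n d : nat) (R : 'I_n -> 'I_n -> 'I_d.+1) (u0 : 'I_n)
  (E : 'I_d.+1 -> 'M[algC]_n) (P : 'M[algC]_d.+1) :
  P_polynomial_scheme R ->
  formally_self_dual_ordering R E P ->
  (Hom_mx R u0 0%N + Hom_mx R u0 1%N == L_mx (E ord0) + L_mx (E (inord 1)))%MS ->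
  (6 <= d)%N ->
  is_Hamming R.
Proof.
case=> scheme distR self_dual /andP[HomL LHom] d6.
have d2 : (2 <= d)%N by apply: leq_trans d6.
have d1 : (0 < d)%N by apply: ltnW.
have R_sym := scheme_sym scheme; have R_eq0 := scheme_eq0 distR.
(* Column 1 of [P] indexed by naturals; [inord] is faithful on all values of [R]. *)
pose th i := P (inord i) (inord 1) : algC.
have thE x y : th (R x y) = P (R x y) (inord 1) by rewrite /th inord_val.
have i1E x y : (R x y == inord 1) = (R x y == 1%N :> nat).
  by rewrite -val_eqE /= inordK.
apply: (@hamming_of_closer_eigen _ algC d (fun x y => R x y) u0 th) => //=.
- by move=> x y; rewrite R_sym.
- exact: scheme_tri.
- exact: scheme_step.
- by move=> x y; rewrite -ltnS.
- exact: scheme_onto.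
- exact: scheme_reg.
- move=> z; rewrite inE => /eqP u0z.
  have [|c cE] := fz_eigen R_eq0 self_dual u0z.
    exact: submx_trans (addsmxSr _ _) HomL.
  exists c => x; have := cE x; rewrite fz1 // => <-.
  by apply: eq_big => [y|y _]; rewrite ?i1E ?fz1.
- move=> x y; rewrite !thE (eigenmatrix_rep (u0 := u0) R_eq0 self_dual R_sym).
    congr (_ + _); apply: eq_big => [z|z /eqP u0z]; first by rewrite inE.
    by rewrite thE fz1.
  exact: submx_trans (addsmxSr _ _) LHom.
- move=> x w; rewrite thE -(eigenmatrix_eigen self_dual).
  by apply: eq_big => [y|y _]; rewrite ?i1E ?thE.
- move=> x; rewrite /th (_ : inord 0 = ord0); last by apply: val_inj; rewrite /= inordK.
  rewrite (eigenmatrix_row0 R_eq0 self_dual _ x).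
  by congr (_ %:R); apply: eq_card => y; rewrite !inE i1E.
Qed.
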